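(* Let $A, B, C, D \in \mathcal{C}_2(\mathcal{H})$, let $0\leq \nu \leq 1$ and let $\theta \in \mathbb{R}$. Then: (i) $w_{(2,\nu)}\left(\begin{bmatrix} 0 & A \\ B & 0 \end{bmatrix}\right) = w_{(2,\nu)}\left(\begin{bmatrix} 0 & B \\ A & 0 \end{bmatrix}\right)$. (ii) $w_{(2,\nu)}\left(\begin{bmatrix} 0 & A \\ B & 0 \end{bmatrix}\right) = w_{(2,\nu)}\left(\begin{bmatrix} 0 & A \\ e^{i\theta}B & 0 \end{bmatrix}\right)$. (iii) $w_{(2,\nu)}\left(\begin{bmatrix} A & A \\ -A & -A \end{bmatrix}\right) = 2\sqrt{2\nu^2-2\nu+1}\,\|A\|_{2}$. (iv) $w_{(2,\nu)}\left(\begin{bmatrix} 0 & A \\ A & 0 \end{bmatrix}\right) = \sqrt{2}\,w_{(2,\nu)}(A)$. (v) $w_{(2,\nu)}^2\left(\begin{bmatrix} A & B \\ 0 & 0 \end{bmatrix}\right) = w_{(2,\nu)}^2(A) + (2\nu^2-2\nu+1)\|B\|_{2}^2$. (vi) If $\mathrm{tr}(BC) = 0$, then $w_{(2,\nu)}^2\left(\begin{bmatrix} A & B \\ C & iA \end{bmatrix}\right) = (2\nu^2-2\nu+1)\left(2\|A\|_{2}^2 + \|B\|_{2}^2+\|C\|_{2}^2\right)$. (vii) If $A, B$ are positive, then $w_{(2,\nu)}^2\left(\begin{bmatrix} 0 & A \\ B & 0 \end{bmatrix}\right) = \dfrac{\|A+B\|_{2}^2 + (1-2\nu)^2\|A-B\|_{2}^2}{2}$.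 (viii) If $A, B$ are self-adjoint, then $w_{(2,\nu)}^2\left(\begin{bmatrix} A & 0 \\ 0 & B \end{bmatrix}\right) = w_{(2,\nu)}^2(A) + w_{(2,\nu)}^2(B)$. (ix) If $A, B$ are self-adjoint, then $w_{(2,\nu)}^2\left(\begin{bmatrix} A & B \\ B & A \end{bmatrix}\right) = w_{(2,\nu)}^2(A+B) + w_{(2,\nu)}^2(A-B)$.
   Context: $\mathcal{H}$ is a complex Hilbert space. For a complex Hilbert space $\mathcal{K}$, $\mathcal{C}_2(\mathcal{K})$ is the Hilbert--Schmidt class, i.e. the bounded linear operators $T$ on $\mathcal{K}$ with $\|T\|_2=\sqrt{\mathrm{tr}(T^*T)}<\infty$, where $\mathrm{tr}$ is the usual trace. For $0\leq\nu\leq1$ and $T\in\mathcal{C}_2(\mathcal{K})$, define $$w_{(2,\nu)}(T)=\sup_{\varphi\in\mathbb{R}}\left\|\nu e^{i\varphi}T+(1-\nu)e^{-i\varphi}T^*\right\|_2,$$ and $w_{(2,\nu)}^2(T)$ means $\left(w_{(2,\nu)}(T)\right)^2$. The $2\times2$ operator matrices act on $\mathcal{H}\oplus\mathcal{H}$, and $w_{(2,\nu)}$ of them is taken with $\mathcal{K}=\mathcal{H}\oplus\mathcal{H}$. ''Positive'' means positive semidefinite. *)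

(* Defs.v *)
From HB Require Import structures.
From mathcomp Require Import all_boot all_order all_algebra.
From mathcomp Require Import complex.
From mathcomp Require Import all_classical all_reals all_analysis.
From mathcomp Require Import ring.
From mathcomp Require showcase.summability.

Set Implicit Arguments.
Unset Strict Implicit.
Unset Printing Implicit Defensive.

Import Order.TTheory GRing.Theory Num.Def Num.Theory.
Import numFieldNormedType.Exports.

Local Open Scope classical_set_scope.
Local Open Scope ring_scope.
Local Open Scope complex_scope.

(* The inner product is linear in its first argument and conjugate-linear in
   its second one. *)
HB.mixin Record CompleteNormedModule_isHilbert (R : realType) H
    & CompleteNormedModule R[i] H := {
  inner : {dot H for conjC};
  inner_norm : forall x : H, inner x x = `|x| ^+ 2
}.

#[short(type="hilbertType")]
HB.structure Definition Hilbert (R : realType) :=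
  {H of CompleteNormedModule R[i] H & CompleteNormedModule_isHilbert R H}.

(* The orthogonal direct sum: unlike the library's normed module on the
   product H * K, whose norm is the maximum of the two norms, it has the norm
   of the inner product <x1, y1> + <x2, y2>. *)
Definition dsum (H K : Type) : Type := (H * K)%type.
Notation "H \(+) K" := (dsum H K) (at level 50, left associativity) : type_scope.

HB.instance Definition _ (R : realType) (H K : hilbertType R) :=
  GRing.Lmodule.copy (H \(+) K) (H * K)%type.

Section DirectSum.
Context (R : realType) (H K : hilbertType R).
Implicit Types x y : H \(+) K.

Definition dsum_inner x y : R[i] := inner x.1 y.1 + inner x.2 y.2.

Lemma dsum_inner_bilinear :
  bilinear_for (GRing.Scale.Law.clone _ _ *%R _)
    (GRing.Scale.Law.clone _ _ (conjC \; *%R) _) dsum_inner.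
Proof.
split=> [y|x] a u v; rewrite /dsum_inner /= ?linearPl ?linearPr /=.
  by rewrite mulrDr addrACA.
by rewrite mulrDr addrACA.
Qed.

HB.instance Definition _ :=
  bilinear_isBilinear.Build R[i] (H \(+) K) (H \(+) K) R[i]
    _ _ dsum_inner dsum_inner_bilinear.

Lemma dsum_inner_hermitian x y :
  dsum_inner x y = (-1) ^+ false * conjC (dsum_inner y x).
Proof.
rewrite expr0 mul1r /dsum_inner rmorphD.
by rewrite (hermitian_subproof (s := inner) x.1) expr0 mul1r
  (hermitian_subproof (s := inner) x.2) expr0 mul1r.
Qed.

HB.instance Definition _ :=
  isHermitianSesquilinear.Build R[i] (H \(+) K) false conjC
    dsum_inner dsum_inner_hermitian.

Lemma dsum_innerE x : dsum_inner x x = `|x.1| ^+ 2 + `|x.2| ^+ 2.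
Proof. by rewrite /dsum_inner !inner_norm. Qed.

Lemma dsum_inner_gt0 x : x != 0 -> 0 < dsum_inner x x.
Proof.
move=> x0; rewrite dsum_innerE lt0r addr_ge0 ?exprn_ge0// andbT.
apply: contra x0; rewrite paddr_eq0 ?exprn_ge0// !expf_eq0 /= !normr_eq0.
by case: x => a b /= /andP[/eqP-> /eqP->].
Qed.

HB.instance Definition _ :=
  isDotProduct.Build R[i] (H \(+) K) dsum_inner dsum_inner_gt0.

Definition dsum_norm x : R[i] := sqrtC (`|x.1| ^+ 2 + `|x.2| ^+ 2).

Lemma dsum_norm_ge0 x : 0 <= dsum_norm x.
Proof. by rewrite sqrtC_ge0 addr_ge0 ?exprn_ge0. Qed.

Lemma dsum_normrZ (a : R[i]) x : dsum_norm (a *: x) = `|a| * dsum_norm x.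
Proof.
rewrite /dsum_norm /= !normrZ !exprMn -mulrDr sqrtCM ?nnegrE ?addr_ge0 ?exprn_ge0//.
by rewrite sqrCK.
Qed.

Lemma dsum_norm0_eq0 x : dsum_norm x = 0 -> x = 0.
Proof.
move=> /eqP; rewrite sqrtC_eq0; case: (eqVneq x 0) => // /dsum_inner_gt0.
by rewrite dsum_innerE => /gt_eqF ->.
Qed.

Lemma dsum_ler_normD x y : dsum_norm (x + y) <= dsum_norm x + dsum_norm y.
Proof.
rewrite -(@ler_pXn2r _ 2)// ?nnegrE ?addr_ge0 ?dsum_norm_ge0// sqrrD !sqrtCK.
set a := `|x.1|; set b := `|x.2|; set c := `|y.1|; set d := `|y.2|.
have [a0 b0 c0 d0] : [/\ 0 <= a, 0 <= b, 0 <= c & 0 <= d].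
  by split; exact: normr_ge0.
have cauchy_schwarz : a * c + b * d <= dsum_norm x * dsum_norm y.
  rewrite -(@ler_pXn2r _ 2)// ?nnegrE ?addr_ge0 ?mulr_ge0 ?dsum_norm_ge0//.
  rewrite exprMn !sqrtCK -/a -/b -/c -/d -subr_ge0.
  rewrite (_ : _ - _ = (a * d - b * c) ^+ 2); last by ring.
  by rewrite -realEsqr realB// realM// ger0_real.
have le1 : `|(x + y).1| ^+ 2 <= (a + c) ^+ 2.
  by rewrite ler_pXn2r ?nnegrE ?addr_ge0 ?ler_normD.
have le2 : `|(x + y).2| ^+ 2 <= (b + d) ^+ 2.
  by rewrite ler_pXn2r ?nnegrE ?addr_ge0 ?ler_normD.
apply: (le_trans (lerD le1 le2)); rewrite -subr_ge0.
rewrite (_ : _ - _ =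
  (dsum_norm x * dsum_norm y - (a * c + b * d)) *+ 2); last by ring.
by rewrite mulrn_wge0 // subr_ge0.
Qed.

HB.instance Definition _ :=
  Lmodule_isNormed.Build R[i] (H \(+) K)
    dsum_ler_normD dsum_normrZ dsum_norm0_eq0.

Lemma dsum_normE x : `|x| = dsum_norm x. Proof. by []. Qed.

Lemma dsum_norm_fst x : `|x.1| <= `|x|.
Proof.
by rewrite dsum_normE -(@ler_pXn2r _ 2)// ?nnegrE ?dsum_norm_ge0// sqrtCK
  lerDl exprn_ge0.
Qed.

Lemma dsum_norm_snd x : `|x.2| <= `|x|.
Proof.
by rewrite dsum_normE -(@ler_pXn2r _ 2)// ?nnegrE ?dsum_norm_ge0// sqrtCK
  lerDr exprn_ge0.
Qed.

Lemma dsum_norm_le x : `|x| <= `|x.1| + `|x.2|.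
Proof.
rewrite dsum_normE -(@ler_pXn2r _ 2)// ?nnegrE ?dsum_norm_ge0 ?addr_ge0//.
by rewrite sqrtCK sqrrD addrAC lerDl mulrn_wge0 ?mulr_ge0.
Qed.

Lemma dsum_complete (F : set_system (H \(+) K)) :
  ProperFilter F -> cauchy F -> cvg F.
Proof.
move=> FF /cauchy_ballP F_cauchy.
have cauchy_image (V : completeNormedModType R[i]) (p : H \(+) K -> V) :
    (forall x y, `|p x - p y| <= `|x - y|) -> cvg (p @ F).
  move=> p_le; apply: cauchy_cvg; apply/cauchy_ballP => e e0.
  rewrite near_map2.
  apply: filterS (F_cauchy _ e0) => -[x y] /=.
  by rewrite -!ball_normE; apply: le_lt_trans.
have /cvg_ex[l1 Fl1] := cauchy_image H fst (fun x y => dsum_norm_fst (x - y)).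
have /cvg_ex[l2 Fl2] := cauchy_image K snd (fun x y => dsum_norm_snd (x - y)).
apply/cvg_ex; exists ((l1, l2) : H \(+) K).
apply/cvgrPdist_lt => e e0; near=> x.
apply: le_lt_trans (dsum_norm_le _) _; rewrite (splitr e) ltrD//=.
  by near: x; move/cvgrPdist_lt : Fl1; apply; rewrite divr_gt0.
by near: x; move/cvgrPdist_lt : Fl2; apply; rewrite divr_gt0.
Unshelve. all: by end_near. Qed.

HB.instance Definition _ := Uniform_isComplete.Build (H \(+) K) dsum_complete.

Lemma dsum_inner_norm x : dsum_inner x x = `|x| ^+ 2.
Proof. by rewrite dsum_innerE dsum_normE sqrtCK. Qed.

HB.instance Definition _ :=
  CompleteNormedModule_isHilbert.Build R (H \(+) K) dsum_inner_norm.

End DirectSum.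

Section Operators.
Context (R : realType).
Implicit Types (H : hilbertType R).

Definition bounded_linear H (T : H -> H) : Prop :=
  linear T /\ exists M : R[i], forall x, `|T x| <= M * `|x|.

(* The adjoint T^*: the function characterized by <T x, y> = <x, T^* y>. It is
   unique, and exists whenever T is a bounded linear operator. *)
Definition adjoint H (T : H -> H) : H -> H :=
  xget (fun=> 0) [set S | forall x y, inner (T x) y = inner x (S y)].

Definition self_adjoint H (T : H -> H) : Prop := adjoint T = T.

(* 0 <= z in R[i] means that z is a nonnegative real number. *)
Definition positive H (T : H -> H) : Prop := forall x, 0 <= inner (T x) x.

Definition orthonormal_basis H (E : set H) : Prop :=
  (forall e f, E e -> E f -> inner e f = (e == f)%:R) /\
  (forall x, (forall e, E e -> inner x e = 0) -> x = 0).

(* Every Hilbert space has an orthonormal basis; one is chosen. *)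
Definition onb H : set H := xget set0 [set E | @orthonormal_basis H E].
Arguments onb : clear implicits.

(* The trace is the sum of <T e, e> over the vectors e of the basis, possibly
   uncountably many: the limit of the finite partial sums, ordered by inclusion
   of their index sets. For positive operators its convergence, and for trace
   class operators its value, do not depend on the chosen basis. *)
Definition diag_coef H (T : H -> H) (e : onb H) : R[i]^o :=
  inner (T (val e)) (val e).

Definition trace H (T : H -> H) : R[i] := summability.sum (diag_coef T).

Definition trace_converges H (T : H -> H) : Prop :=
  cvg (summability.partial_sum (diag_coef T) @ summability.totally).

Definition hilbert_schmidt H (T : H -> H) : Prop :=
  bounded_linear T /\ trace_converges (adjoint T \o T).

(* On a Hilbert-Schmidt operator the trace below is a nonnegative real number,
   so that taking its real part only changes its type. *)
Definition hs_norm H (T : H -> H) : R :=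
  Num.sqrt (complex.Re (trace (adjoint T \o T))).

Definition expi (t : R) : R[i] := cos t +i* sin t.

Definition w2 (nu : R) H (T : H -> H) : R :=
  sup [set hs_norm ((nu%:C * expi phi) *: T
                    + ((1 - nu)%:C * expi (- phi)) *: adjoint T)
      | phi in [set: R]].

(* The operator matrix with rows (A, B) and (C, D). *)
Definition opmx H (A B C D : H -> H) : H \(+) H -> H \(+) H :=
  fun x => (A x.1 + B x.2, C x.1 + D x.2).

End Operators.

Arguments onb {R} H.

(* Main.v *)
Require Import Defs.
From mathcomp Require Import all_boot all_order all_algebra.
From mathcomp Require Import complex.
From mathcomp Require Import all_classical all_reals all_analysis.
From mathcomp Require Import ring lra.
From mathcomp Require Import finmap.
From mathcomp Require showcase.summability.
Import Order.TTheory GRing.Theory Num.Theory.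
Import numFieldNormedType.Exports.
Set Implicit Arguments.
Unset Strict Implicit.
Unset Printing Implicit Defensive.
Local Open Scope classical_set_scope.
Local Open Scope ring_scope.
Local Open Scope complex_scope.

(** Everything reduces to one closed formula: for a Hilbert-Schmidt operator [T],
<<
  w2 nu T ^ 2 = (2 nu^2 - 2 nu + 1) |T|^2 + 2 nu (1 - nu) |tr (T T)|
>>
    ([w2E], [w2_sqr]). It comes from expanding the squared norm of
    [u T + v T^*] as [|u|^2 |T|^2 + |v|^2 |T^*|^2 + 2 Re (u v^* <T, T^*>)], where
    [|T^*| = |T|] and [<T, T^*> = tr (T T)]: for [u = nu e^(i phi)] and
    [v = (1 - nu) e^(- i phi)] only the factor [e^(2 i phi)] of the last term
    depends on [phi], and some [phi] makes that term equal to its modulus.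

    For an operator matrix [M] with rows (A, B) and (C, D),
<<
  |M|^2 = |A|^2 + |B|^2 + |C|^2 + |D|^2,
  tr (M M) = tr (A A) + 2 tr (B C) + tr (D D)
>>
    ([hsn_opmx], [trace_opmx]), and the nine identities are then arithmetic. The
    positive case also needs [tr (B A) >= 0] ([trace_ge0]), and the self-adjoint
    ones use [tr (A A) = |A|^2].

    The trace is a limit of finite sums over one chosen basis, so the work lies in
    making these sums independent of bases. Parseval's identity ([parseval]) and the
    exchange of two sums of nonnegative terms give, for a pair of adjoint
    operators [T : H -> K] and [S : K -> H],
    [sum_e |T e|^2 = sum_e sum_f |<T e, f>|^2 = sum_f |S f|^2] ([hs2_adjoint]),
    where [e] runs over the basis of [H] and [f] over that of [K]. With [H = K] this
    is [|T^*| = |T|]; applied to the rows of an operator matrix, which map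
    [H \(+) H] to [H], it computes the norm of the matrix without any link between
    the chosen bases of [H \(+) H] and of [H]. Inner products of operators, and
    with them the traces of products, follow from squared norms by polarization. *)

Local Existing Instance summability.totally_filter.

Local Notation conjC := Num.conj.

(** * Unordered sums *)

(** The type of the values is a normed module, so complex sums are taken in [R[i]^o]. *)
Definition has_sum (R : realType) (I : choiceType) (V : normedModType R[i])
    (f : I -> V) (l : V) : Prop :=
  summability.partial_sum f @ summability.totally --> l.

Section NetSums.
Context (R : realType).

Lemma has_sumP (I : choiceType) (V : normedModType R[i]) (f : I -> V) (l : V) :
  has_sum f l <-> forall e : R[i], 0 < e -> exists A : {fset I},
    forall B : {fset I}, (A `<=` B)%fset ->
      `|l - \sum_(i <- B) f i| < e.
Proof.
rewrite /has_sum; split=> [/cvgrPdist_lt h e e0|h].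
  have [A _ hA] := h e e0; exists A => B AB; have := hA B AB.
  by rewrite /= /summability.partial_sum big_seq_fsetE.
apply/cvgrPdist_lt => e e0; have [A hA] := h e e0.
exists A => // B AB; rewrite /= /summability.partial_sum -(big_seq_fsetE _ B xpredT).
exact: hA.
Qed.

Lemma has_sum_unique (I : choiceType) (V : normedModType R[i]) (f : I -> V) (l m : V) :
  has_sum f l -> has_sum f m -> l = m.
Proof. exact: cvg_unique. Qed.

Lemma has_sumD (I : choiceType) (V : normedModType R[i]) (f g : I -> V) (l m : V) :
  has_sum f l -> has_sum g m -> has_sum (fun i => f i + g i) (l + m).
Proof.
rewrite /has_sum => fl gm; rewrite (_ : summability.partial_sum _ =
  summability.partial_sum f \+ summability.partial_sum g); first exact: cvgD.
by apply/funext => B; rewrite /summability.partial_sum big_split.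
Qed.

Lemma has_sumZ (I : choiceType) (V : normedModType R[i]) (c : R[i]) (f : I -> V) (l : V) :
  has_sum f l -> has_sum (fun i => c *: f i) (c *: l).
Proof.
rewrite /has_sum => fl; rewrite (_ : summability.partial_sum _ =
  c \*: summability.partial_sum f); first exact: cvgZr.
by apply/funext => B; rewrite /summability.partial_sum /= scaler_sumr.
Qed.

Lemma esum_ge_fset (I : choiceType) (a : I -> \bar R) (B : {fset I}) :
  (forall i, 0 <= a i)%E -> (\sum_(i <- B) a i <= \esum_(i in setT) a i)%E.
Proof.
move=> a0; apply: esum_ge; exists [set` B]; first by split=> //; exact: finite_fset.
by rewrite fsbig_finite ?finite_fset//= set_fsetK.
Qed.

Lemma esum_le_fset (I : choiceType) (a : I -> \bar R) (M : \bar R) :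
  (forall B : {fset I}, \sum_(i <- B) a i <= M)%E -> (\esum_(i in setT) a i <= M)%E.
Proof.
move=> h; apply: ge_ereal_sup => _ [X [finX _] <-].
by rewrite fsbig_finite.
Qed.

Lemma esum_fin_num (I : choiceType) (a : I -> \bar R) :
  (forall i, 0 <= a i)%E -> (\esum_(i in setT) a i < +oo)%E ->
  (fine (\esum_(i in setT) a i))%:E = \esum_(i in setT) a i.
Proof.
move=> a0 h; rewrite fineK// ge0_fin_numE//; apply: esum_ge0 => i _; exact: a0.
Qed.

Lemma big_realC (I : Type) (r : seq I) (a : I -> R) :
  \sum_(i <- r) (a i)%:C = (\sum_(i <- r) a i)%:C :> R[i].
Proof. by rewrite rmorph_sum. Qed.

Lemma posC (e : R[i]) : 0 < e -> exists2 r : R, 0 < r & e = r%:C.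
Proof.
move=> e0; exists (complex.Re e); last by rewrite RRe_real// gtr0_real.
by move: e0; rewrite ltcE => /andP[].
Qed.

Lemma normC_real (x : R) : `|x%:C| = `|x|%:C.
Proof. by rewrite normc_def /= expr0n addr0 sqrtr_sqr. Qed.

Lemma big_fset_split (I : choiceType) (V : zmodType) (f : I -> V) (A B : {fset I}) :
  (A `<=` B)%fset ->
  \sum_(i <- B) f i = \sum_(i <- A) f i + \sum_(i <- (B `\` A)%fset) f i.
Proof.
move=> /fsetIidPr AB; rewrite (big_fsetID _ (mem A)) /=; congr (_ + _).
  rewrite -[in RHS]AB; apply: eq_fbigl => x; rewrite !inE/=.
  by rewrite andbC.
by apply: eq_fbigl => x; rewrite !inE/= andbC.
Qed.

Lemma esum_approx (I : choiceType) (a : I -> R) (l e : R) :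
  \esum_(i in setT) (a i)%:E = l%:E -> 0 < e ->
  exists A : {fset I}, l - e < \sum_(i <- A) a i.
Proof.
move=> h e0; have [|y [X [finX _] <-]] := @ereal_sup_gt R
  [set \sum_(x \in A) (a x)%:E | A in fsets setT]%E (l - e)%:E.
  by rewrite -/(esum _ _) h lte_fin ltrBlDr ltrDl.
rewrite fsbig_finite//= sumEFin lte_fin => lt_l.
by exists (fset_set X).
Qed.

(** The bridge between limits of complex partial sums, by which traces are defined, and
    extended real sums, for which summations can be exchanged. *)
Lemma has_sum_ge0P (I : choiceType) (a : I -> R) (l : R) :
  (forall i, 0 <= a i) ->
  has_sum ((fun i => (a i)%:C) : I -> R[i]^o) (l%:C : R[i]^o) <->
  \esum_(i in setT) (a i)%:E = l%:E.
Proof.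
move=> a0; have aE0 i : (0 <= (a i)%:E)%E by rewrite lee_fin.
have mono (A B : {fset I}) : (A `<=` B)%fset -> \sum_(i <- A) a i <= \sum_(i <- B) a i.
  by move=> /big_fset_split->; rewrite lerDl sumr_ge0.
have distE B : `|l%:C - \sum_(i <- B) (a i)%:C| = `|l - \sum_(i <- B) a i|%:C.
  by rewrite big_realC -rmorphB normC_real.
split=> [/has_sumP h|h].
- apply/eqP; rewrite eq_le; apply/andP; split.
    apply: esum_le_fset => B; rewrite sumEFin lee_fin; apply/ler_addgt0Pr => e e0.
    have [|A hA] := h e%:C; first by rewrite ltcR.
    have := hA (A `|` B)%fset (fsubsetUl _ _).
    rewrite distE ltcR distrC => /ltr_distlDr/ltW; apply: le_trans.
    exact/mono/fsubsetUr.
  apply/lee_addgt0Pr => e e0.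
  have [|A hA] := h e%:C; first by rewrite ltcR.
  have := hA A (fsubset_refl _); rewrite distE ltcR => /ltr_distlDr/ltW lA.
  apply: (@le_trans _ _ (\sum_(i <- A) a i + e)%:E); first by rewrite lee_fin.
  rewrite EFinD leeD// -sumEFin; exact: esum_ge_fset.
- apply/has_sumP => _ /posC[e e0 ->].
  have [A hA] := esum_approx h e0; exists A => B AB.
  rewrite distE ltcR ger0_norm ?subr_ge0.
    by rewrite ltrBlDr -ltrBlDl; apply: lt_le_trans hA (mono _ _ AB).
  by rewrite -lee_fin -h -sumEFin; apply: esum_ge_fset.
Qed.

(** The Cauchy criterion: the partial sums beyond [A] differ from that over [A] by sums
    over sets disjoint from [A]. *)
Lemma has_sum_cauchy (I : choiceType) (V : completeNormedModType R[i]) (f : I -> V) :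
  (forall e : R[i], 0 < e -> exists A : {fset I}, forall B : {fset I},
     [disjoint A & B]%fset -> `|\sum_(i <- B) f i| < e) ->
  exists l : V, has_sum f l.
Proof.
move=> h; suff /cvg_ex[l fl] :
  cvg (summability.partial_sum f @ summability.totally) by exists l.
apply: cauchy_cvg; apply: cauchy_exP => e e0.
have [A hA] := h e e0; exists (\sum_(i <- A) f i).
exists A => // B AB; rewrite /= -ball_normE /= /summability.partial_sum.
rewrite -(big_seq_fsetE _ B xpredT) (big_fset_split _ AB) opprD addNKr normrN.
by apply: hA; rewrite fdisjoint_sym; have /fsubsetDP[] := fsubset_refl (B `\` A)%fset.
Qed.

(** The nonnegative numbers are closed, and a limit of partial sums is already the limit
    along a cofinal family of index sets. *)
Lemma has_sum_cofinal_ge0 (I : choiceType) (f : I -> R[i]^o) (l : R[i]^o) :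
  has_sum f l ->
  (forall A : {fset I}, exists2 B : {fset I}, (A `<=` B)%fset & 0 <= \sum_(i <- B) f i :> R[i]) ->
  0 <= l :> R[i].
Proof.
move=> /has_sumP fl h.
have hr (r : R) : 0 < r -> `|complex.Im l| <= r /\ - r <= complex.Re l.
  move=> r0; have [|A hA] := fl r%:C; first by rewrite ltcR.
  have [B AB] := h A; have := hA B AB; set s : R[i] := \sum_(i <- B) _.
  rewrite lecE/= => /[swap] /andP[/eqP s0 s1].
  rewrite normc_def ltcR !raddfB/= s0 subr0 => lr.
  have ler : Num.sqrt ((complex.Re l - complex.Re s) ^+ 2 + complex.Im l ^+ 2) <= r.
    exact: ltW.
  have sq t : t ^+ 2 <= (complex.Re l - complex.Re s) ^+ 2 + complex.Im l ^+ 2 -> `|t| <= r.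
    by move=> /ler_wsqrtr; rewrite sqrtr_sqr => /le_trans; apply.
  split; first by apply: sq; rewrite lerDr sqr_ge0.
  have /sq : (complex.Re l - complex.Re s) ^+ 2 <=
    (complex.Re l - complex.Re s) ^+ 2 + complex.Im l ^+ 2 by rewrite lerDl sqr_ge0.
  by rewrite ler_norml => /andP[+ _]; lra.
rewrite lecE /=; apply/andP; split.
  rewrite -normr_le0; apply/ler_addgt0Pr => r r0.
  by rewrite add0r; have [] := hr r r0.
by apply/ler_addgt0Pr => r r0; rewrite -lerBlDr sub0r; have [] := hr r r0.
Qed.

End NetSums.

Arguments has_sum_unique {R I V f l m} _ _.
Arguments has_sumD {R I V f g l m} _ _.
Arguments has_sumZ {R I V} c {f l} _.

(** * Inner products *)

Section InnerProduct.
Context (R : realType).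
Implicit Types H K : hilbertType R.

(** The squared modulus, as a real number. *)
Definition csq (z : R[i]) : R := complex.Re z ^+ 2 + complex.Im z ^+ 2.

(** The squared norm, as a real number: the norm itself takes its values in [R[i]]. *)
Definition nsq H (x : H) : R := complex.Re (inner x x).

Lemma csqE (z : R[i]) : (csq z)%:C = z * conjC z.
Proof. by rewrite /csq add_Re2_Im2 normCK. Qed.

Lemma csq_ge0 z : 0 <= csq z. Proof. by rewrite addr_ge0 ?sqr_ge0. Qed.

Lemma csq_conj z : csq (conjC z) = csq z.
Proof. by case: z => a b; rewrite /csq /= sqrrN. Qed.

Lemma csqM y z : csq (y * z) = csq y * csq z.
Proof. by case: y z => a b [c d]; rewrite /csq /=; ring. Qed.

Lemma innerDl H (x y z : H) : inner (x + y) z = inner x z + inner y z.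
Proof. exact: linearDl. Qed.

Lemma innerDr H (x y z : H) : inner x (y + z) = inner x y + inner x z.
Proof. exact: linearDr. Qed.

Lemma innerNl H (x y : H) : inner (- x) y = - inner x y.
Proof. exact: linearNl. Qed.

Lemma innerNr H (x y : H) : inner x (- y) = - inner x y.
Proof. exact: linearNr. Qed.

Lemma innerBl H (x y z : H) : inner (x - y) z = inner x z - inner y z.
Proof. by rewrite innerDl innerNl. Qed.

Lemma innerBr H (x y z : H) : inner x (y - z) = inner x y - inner x z.
Proof. by rewrite innerDr innerNr. Qed.

Lemma innerZl H (a : R[i]) (x y : H) : inner (a *: x) y = a * inner x y.
Proof. exact: linearZl_LR. Qed.

Lemma innerZr H (a : R[i]) (x y : H) : inner x (a *: y) = conjC a * inner x y.
Proof. exact: linearZr_LR. Qed.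

Lemma inner0l H (y : H) : inner 0 y = 0.
Proof. exact: linear0l. Qed.

Lemma inner0r H (y : H) : inner y 0 = 0.
Proof. exact: linear0r. Qed.

Lemma inner_suml H (I : Type) (r : seq I) (f : I -> H) y :
  inner (\sum_(i <- r) f i) y = \sum_(i <- r) inner (f i) y.
Proof. exact: linear_sumlz. Qed.

Lemma inner_sumr H (I : Type) (r : seq I) (f : I -> H) y :
  inner y (\sum_(i <- r) f i) = \sum_(i <- r) inner y (f i).
Proof. exact: linear_sumr. Qed.

Lemma innerC H (x y : H) : inner x y = conjC (inner y x).
Proof. by rewrite (hermitian_subproof (s := inner) x) expr0 mul1r. Qed.

Lemma nsqE H (x : H) : (nsq x)%:C = inner x x.
Proof. by rewrite /nsq RRe_real// inner_norm realX// normr_real. Qed.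

Lemma nsq_normE H (x : H) : (nsq x)%:C = `|x| ^+ 2.
Proof. by rewrite nsqE inner_norm. Qed.

Lemma nsq_ge0 H (x : H) : 0 <= nsq x.
Proof. by rewrite -ler0c nsq_normE exprn_ge0. Qed.

Lemma nsq_eq0 H (x : H) : nsq x = 0 -> x = 0.
Proof.
move=> x0; apply/eqP; rewrite -normr_eq0 -sqrf_eq0 -nsq_normE x0.
exact: eqxx.
Qed.

Lemma nsqZ H a (x : H) : nsq (a *: x) = csq a * nsq x.
Proof.
apply: complexI; rewrite nsqE innerZl innerZr mulrA rmorphM/= csqE nsqE.
by [].
Qed.

Lemma nsqN H (x : H) : nsq (- x) = nsq x.
Proof. by rewrite /nsq innerNl innerNr opprK. Qed.

Lemma nsqDZ H u v (x y : H) :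
  nsq (u *: x + v *: y) = csq u * nsq x + csq v * nsq y
    + 2 * complex.Re (u * conjC v * inner x y).
Proof.
rewrite -!nsqZ /nsq innerDl !innerDr.
have -> : inner (v *: y) (u *: x) = conjC (inner (u *: x) (v *: y)) by exact: innerC.
have -> : u * conjC v * inner x y = inner (u *: x) (v *: y).
  by rewrite innerZl innerZr mulrA.
move: (inner (u *: x) (u *: x)) (inner (u *: x) (v *: y)) (inner (v *: y) (v *: y)).
by move=> [a b] [c d] [e f] /=; ring.
Qed.

Lemma nsqD H (x y : H) : nsq (x + y) = nsq x + nsq y + 2 * complex.Re (inner x y).
Proof.
have := nsqDZ 1 1 x y; rewrite !scale1r rmorph1 !mul1r => ->.
by rewrite /csq/= !(expr1n, expr0n) addr0 !mul1r.
Qed.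

(** The squared norm of [|y|^2 x - <x, y> y] is
    [|y|^2 (|x|^2 |y|^2 - |<x, y>|^2)]. *)
Lemma cauchy_schwarz H (x y : H) : csq (inner x y) <= nsq x * nsq y.
Proof.
have [y0|y0] := eqVneq (nsq y) 0.
  rewrite (nsq_eq0 y0) inner0r /csq /= expr0n/= addr0 mulr_ge0 ?nsq_ge0//.
have yp : 0 < nsq y by rewrite lt_def y0 nsq_ge0.
have := nsq_ge0 ((nsq y)%:C *: x + (- inner x y) *: y).
rewrite nsqDZ.
have -> : (nsq y)%:C * conjC (- inner x y) * inner x y = - (nsq y * csq (inner x y))%:C.
  by rewrite rmorphN/= mulrN mulNr -mulrA [X in _ * X]mulrC -csqE rmorphM.
have -> : csq (- inner x y) = csq (inner x y).
  by rewrite /csq !raddfN/= !sqrrN.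
rewrite /= [csq _%:C]/csq /= expr0n addr0 => h.
have : 0 <= nsq y * (nsq x * nsq y - csq (inner x y)) by move: h; congr (_ <= _); ring.
by rewrite pmulr_rge0// subr_ge0.
Qed.

Lemma inner_norm_le H (x y : H) : `|inner x y| <= `|x| * `|y|.
Proof.
rewrite -(@ler_pXn2r _ 2)// ?nnegrE ?mulr_ge0// exprMn -!nsq_normE -add_Re2_Im2.
by rewrite -rmorphM lecR cauchy_schwarz.
Qed.

Lemma inner_ext H (x y : H) : (forall z, inner z x = inner z y) -> x = y.
Proof.
move=> h; apply/eqP; rewrite -subr_eq0; apply/eqP/nsq_eq0.
by rewrite /nsq innerBr h subrr.
Qed.

(** A bounded additive map is continuous. Homogeneity is left out so that the lemma
    also applies to real parts. *)
Lemma has_sum_lipschitz (I : choiceType) (V W : normedModType R[i]) (g : V -> W)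
    (M : R[i]) (f : I -> V) (l : V) :
  (forall x y, g (x - y) = g x - g y) ->
  (forall x, `|g x| <= M * `|x|) -> has_sum f l ->
  has_sum (fun i => g (f i)) (g l).
Proof.
move=> gB gM /has_sumP fl; apply/has_sumP => e e0.
have g0 : g 0 = 0 by have := gB 0 0; rewrite !subrr.
have gN x : g (- x) = - g x by rewrite -sub0r gB g0 sub0r.
have gD x y : g (x + y) = g x + g y by rewrite -{1}[y]opprK gB gN opprK.
have gsum (B : {fset I}) : \sum_(i <- B) g (f i) = g (\sum_(i <- B) f i).
  by rewrite (big_morph _ gD g0).
have M0 : 0 < `|M| + 1 by rewrite ltr_wpDl.
have [|A hA] := fl (e / (`|M| + 1)); first by rewrite divr_gt0.
exists A => B /hA; rewrite gsum -gB ltr_pdivlMr// => h.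
apply: le_lt_trans h; apply: (le_trans (gM _)).
have d0 := le_trans (normr_ge0 _) (gM (l - \sum_(i <- B) f i)).
by rewrite -(ger0_norm d0) normrM normr_id mulrC ler_wpM2l// lerDl.
Qed.

Lemma has_sum_innerl (I : choiceType) H (f : I -> H) (l y : H) :
  has_sum f l -> has_sum ((fun i => inner (f i) y) : I -> R[i]^o) (inner l y : R[i]^o).
Proof.
apply: (@has_sum_lipschitz I H R[i]^o (fun x => inner x y) `|y|) => [x z|x].
  exact: innerBl.
by rewrite mulrC; exact: inner_norm_le.
Qed.
Arguments has_sum_innerl {I H f l} y _.
Arguments has_sum_lipschitz {I V W g M f l} _ _ _.

End InnerProduct.
Arguments has_sum_lipschitz {R I V W g M f l} _ _ _.
Arguments has_sum_innerl {R I H f l} y _.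

(** * Orthonormal bases, Parseval's identity and adjoints *)

Section OrthonormalBases.
Context (R : realType).
Implicit Types H K : hilbertType R.

(** Zorn's lemma gives a maximal orthonormal set; a nonzero vector orthogonal to all of
    it could be normalized and added. *)
Lemma orthonormal_basis_exists H : exists E : set H, orthonormal_basis E.
Proof.
pose P := [set E : set H | forall e f, E e -> E f -> inner e f = (e == f)%:R].
have [F FP totF|E [PE maxE]] := @Zorn_bigcup H P.
  move=> e f [X FX Xe] [Y FY Yf].
  have [XY|YX] := totF X Y FX FY.
    by apply: (FP Y FY) => //; exact: XY.
  by apply: (FP X FX) => //; exact: YX.
exists E; split=> // x xE; apply: contrapT => /eqP x0.
pose u := `|x|^-1 *: x.
have uu : inner u u = 1.
  rewrite innerZl innerZr inner_norm fmorphV/= geC0_conj ?normr_ge0// expr2.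
  by rewrite mulrA -invfM mulVf ?mulf_neq0 ?normr_eq0.
have Eu e : E e -> inner u e = 0 by move=> Ee; rewrite innerZl xE ?mulr0.
have uE e : E e -> inner e u = 0 by move=> Ee; rewrite innerC Eu// rmorph0.
have nEu : ~ E u.
  by move=> /Eu; rewrite uu => /eqP; rewrite oner_eq0.
apply: (maxE (E `|` [set u])).
  by split=> [e Ee|/(_ u) h]; [left|apply: nEu; apply: h; right].
move=> e f [Ee|->] [Ef|->]; first exact: PE.
- rewrite uE//; case: eqP => // eu; case: nEu; by rewrite -eu.
- rewrite Eu//; case: eqP => // eu; case: nEu; by rewrite eu.
- by rewrite uu eqxx.
Qed.

Lemma onbP H : orthonormal_basis (onb H).
Proof.
exact: (@xgetPex _ set0 [set E | @orthonormal_basis R H E]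
  (orthonormal_basis_exists H)).
Qed.

Lemma onb_inner H (e f : onb H) : inner (val e) (val f) = (e == f)%:R.
Proof.
have [h _] := onbP H; rewrite h ?(inj_eq val_inj)//.
  exact: set_mem (valP e).
exact: set_mem (valP f).
Qed.

Lemma onb_complete H (x : H) : (forall e : onb H, inner x (val e) = 0) -> x = 0.
Proof.
have [_ h] := onbP H => hx; apply: h => e Ee.
exact: hx (SigSub (mem_set Ee)).
Qed.

Lemma onb_nsq_sum H (c : onb H -> R[i]) (B : {fset onb H}) :
  nsq (\sum_(e <- B) c e *: val e) = \sum_(e <- B) csq (c e).
Proof.
apply: complexI; rewrite nsqE inner_suml -big_realC; apply: eq_big_seq => e eB.
rewrite inner_sumr (bigD1_seq e)//= ?fset_uniq// big1 ?addr0; last first.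
  move=> f fe; rewrite innerZl innerZr onb_inner eq_sym (negbTE fe).
  by rewrite !mulr0.
by rewrite innerZl innerZr onb_inner eqxx mulr1 csqE.
Qed.

Lemma norm_lt H (x : H) (e : R) : 0 < e -> nsq x < e ^+ 2 -> `|x| < e%:C.
Proof.
move=> e0 xe; rewrite -(@ltr_pXn2r _ 2) ?nnegrE ?normr_ge0//.
  by rewrite -nsq_normE -rmorphXn ltcR.
by rewrite ler0c ltW.
Qed.

(** By Pythagoras the sums of [c e *: e] over sets disjoint from a large enough finite
    set are small, and the space is complete. *)
Lemma riesz_fischer H (c : onb H -> R[i]) (l : R) :
  \esum_(e in setT) (csq (c e))%:E = l%:E ->
  exists2 z : H, has_sum (fun e : onb H => c e *: val e) z &
    forall e, inner z (val e) = c e.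
Proof.
move=> cl.
have [_ /posC[e e0 ->]|z hz] := @has_sum_cauchy R (onb H) H (fun e => c e *: val e).
  have [A hA] := esum_approx cl (exprn_gt0 2 e0).
  exists A => B AB.
  apply: norm_lt => //; rewrite onb_nsq_sum.
  have csq0 i : (0 <= (csq (c i))%:E)%E by rewrite lee_fin csq_ge0.
  have := esum_ge_fset (A `|` B)%fset csq0.
  rewrite cl sumEFin lee_fin (big_fset_split _ (fsubsetUl A B)).
  have -> : ((A `|` B) `\` A = B)%fset.
    by rewrite fsetDUl fsetDv fset0U; apply/fsetDidPl; rewrite fdisjoint_sym.
  by move: hA; lra.
exists z => // e; apply: (has_sum_unique (has_sum_innerl (val e) hz)).
apply/has_sumP => r r0; exists [fset e]%fset => B /fsubsetP eB.
rewrite (bigD1_seq e)//= ?fset_uniq ?eB ?inE// big1 ?addr0.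
  by rewrite innerZl onb_inner eqxx mulr1 subrr normr0.
by move=> f fe; rewrite innerZl onb_inner (negbTE fe) mulr0.
Qed.

Lemma bessel H (x : H) (B : {fset onb H}) :
  \sum_(e <- B) csq (inner x (val e)) <= nsq x.
Proof.
set p := \sum_(e <- B) inner x (val e) *: val e.
have := nsq_ge0 (x - p); rewrite nsqD nsqN innerNr raddfN/=.
have -> : inner x p = (\sum_(e <- B) csq (inner x (val e)))%:C.
  rewrite inner_sumr -big_realC; apply: eq_bigr => e _.
  by rewrite innerZr mulrC csqE.
rewrite onb_nsq_sum /=; lra.
Qed.

(** Bessel's inequality makes the expansion converge to some [z] with the same
    coefficients as [x], and by completeness of the basis [z = x]. *)
Lemma fourier_expansion H (x : H) :
  has_sum (fun e : onb H => inner x (val e) *: val e) x.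
Proof.
have c0 (e : onb H) : (0 <= (csq (inner x (val e)))%:E)%E by rewrite lee_fin csq_ge0.
have lt_oo : (\esum_(e in [set: onb H]) (csq (inner x (val e)))%:E < +oo)%E.
  apply: (@le_lt_trans _ _ (nsq x)%:E); last by rewrite ltry.
  by apply: esum_le_fset => B; rewrite sumEFin lee_fin; exact: bessel.
have [z hz zE] := @riesz_fischer H (fun e : onb H => inner x (val e)) _ (esym (esum_fin_num c0 lt_oo)).
have <- : z = x.
  apply/eqP; rewrite -subr_eq0; apply/eqP/onb_complete => e.
  by rewrite innerBl zE subrr.
rewrite (_ : (fun e : onb H => _) = fun e : onb H => inner x (val e) *: val e) //.
by apply/funext => e; rewrite zE.
Qed.
Arguments fourier_expansion {H} x.

Lemma parseval H (x : H) :
  \esum_(e in [set: onb H]) (csq (inner x (val e)))%:E = (nsq x)%:E.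
Proof.
apply/has_sum_ge0P => [e|]; first exact: csq_ge0.
rewrite nsqE; have := has_sum_innerl x (fourier_expansion x).
rewrite (_ : (fun e : onb H => _) = fun e : onb H => (csq (inner x (val e)))%:C) //.
apply/funext => e.
by rewrite innerZl (innerC (val e)) csqE.
Qed.

(** A relation rather than the function [adjoint], which is confined to one space: rows
    and columns of operator matrices are operators between two spaces. Either side of
    the relation is automatically linear. *)
Definition is_adjoint H K (T : H -> K) (S : K -> H) :=
  forall x y, inner (T x) y = inner x (S y).

Lemma is_adjoint_sym H K (T : H -> K) (S : K -> H) :
  is_adjoint T S -> is_adjoint S T.
Proof. by move=> h x y; rewrite innerC -h -innerC. Qed.

Lemma is_adjointE H (T S : H -> H) : is_adjoint T S -> adjoint T = S.
Proof.
move=> h; rewrite /adjoint.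
have /= h' := xgetPex (fun=> 0) (ex_intro [set S | is_adjoint T S] S h).
by apply/funext => y; apply: inner_ext => z; rewrite -h -h'.
Qed.

(** The representing vector has the conjugates of the [g e] as coefficients. For a
    partial sum [x] of its expansion, [g x = |x|^2 <= M |x|], so these coefficients
    have square sums bounded by [M^2]. *)
Lemma riesz H (g : H -> R[i]) (M : R[i]) :
  (forall a x y, g (a *: x + y) = a * g x + g y) ->
  (forall x, `|g x| <= M * `|x|) -> exists z, forall x, g x = inner x z.
Proof.
move=> g_lin gM.
have gB x y : g (x - y) = g x - g y.
  by rewrite addrC -scaleN1r g_lin mulN1r addrC.
have g0 : g 0 = 0 by have := gB 0 0; rewrite !subrr.
have gZ a x : g (a *: x) = a * g x by rewrite -[a *: x]addr0 g_lin g0 addr0.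
have gD x y : g (x + y) = g x + g y by rewrite -[x]scale1r g_lin mul1r scale1r.
pose c (e : onb H) := conjC (g (val e)).
have cM (B : {fset onb H}) : \sum_(e <- B) csq (c e) <= csq M.
  set s := \sum_(e <- B) _.
  have s0 : 0 <= s by rewrite sumr_ge0// => e _; exact: csq_ge0.
  set x := \sum_(e <- B) c e *: val e.
  have gx : g x = s%:C.
    rewrite (big_morph g gD g0) -big_realC; apply: eq_bigr => e _.
    by rewrite gZ -[g _]conjCK csqE.
  have sM : s * s <= csq M * s.
    have := gM x; have := le_trans (normr_ge0 _) (gM x) => M0.
    rewrite -(@ler_pXn2r _ 2) ?nnegrE// gx normC_real ger0_norm//.
    rewrite -(ger0_norm M0) normrM normr_id exprMn -nsq_normE.
    by rewrite -add_Re2_Im2 onb_nsq_sum -rmorphXn -rmorphM lecR.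
  have [->|sn0] := eqVneq s 0; first exact: csq_ge0.
  by rewrite -(@ler_pM2r _ s)// lt_def sn0.
have c0 (e : onb H) : (0 <= (csq (c e))%:E)%E by rewrite lee_fin csq_ge0.
have lt_oo : (\esum_(e in [set: onb H]) (csq (c e))%:E < +oo)%E.
  apply: (@le_lt_trans _ _ (csq M)%:E); last by rewrite ltry.
  by apply: esum_le_fset => B; rewrite sumEFin lee_fin.
have [z hz zE] := @riesz_fischer H c _ (esym (esum_fin_num c0 lt_oo)).
exists z => x.
have hg := @has_sum_lipschitz R _ H R[i]^o g M _ _ gB gM (fourier_expansion x).
have hi := has_sum_innerl z (fourier_expansion x).
apply: (has_sum_unique hg).
rewrite (_ : (fun i : onb H => g _) = fun i : onb H => inner (inner x (val i) *: val i) z) //.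
by apply/funext => e; rewrite gZ innerZl (innerC (val e)) zE conjCK.
Qed.

Lemma adjointP H (T : H -> H) : bounded_linear T -> is_adjoint T (adjoint T).
Proof.
move=> [T_lin [M TM]].
have h y : exists z, forall x, inner (T x) y = inner x z.
  apply: (@riesz _ _ (`|M| * `|y|)) => [a x z|x].
    by rewrite T_lin innerDl innerZl.
  apply: (le_trans (inner_norm_le _ _)); rewrite mulrAC ler_wpM2r//.
  apply: (le_trans (TM x)).
  have d0 := le_trans (normr_ge0 _) (TM x).
  by rewrite -(ger0_norm d0) normrM normr_id.
have [S hS] := choice h.
have adj : is_adjoint T S by move=> x y; exact: hS.
by rewrite (is_adjointE adj).
Qed.

End OrthonormalBases.
Arguments fourier_expansion {R H} x.

(** * Hilbert-Schmidt operators *)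

Section HilbertSchmidt.
Context (R : realType).
Implicit Types H K : hilbertType R.

Lemma esum_swap (I J : choiceType) (a : I -> J -> \bar R) :
  (forall i j, 0 <= a i j)%E ->
  \esum_(i in setT) \esum_(j in setT) a i j =
  \esum_(j in setT) \esum_(i in setT) a i j.
Proof.
move=> a0; rewrite !esum_esum//=.
rewrite (reindex_esum (setT `*`` fun=> setT) _ (fun p => (p.2, p.1)))//=.
split=> [//|[i j] [k l] _ _ [-> ->]//|[i j] _].
by exists (j, i).
Qed.

(** The squared Hilbert-Schmidt norm, in [0, +oo]. *)
Definition hs2 H K (T : H -> K) : \bar R :=
  \esum_(e in [set: onb H]) (nsq (T (val e)))%:E.

(** Both sides are the double sum of [|<T e, f>|^2] by Parseval's identity, once in the
    basis of [K] and once in the basis of [H]. *)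
Lemma hs2_adjoint H K (T : H -> K) (S : K -> H) :
  is_adjoint T S -> hs2 T = hs2 S.
Proof.
move=> TS; rewrite /hs2.
under eq_esum do rewrite -parseval.
under [RHS]eq_esum do rewrite -parseval.
rewrite esum_swap => [|e f]; last by rewrite lee_fin csq_ge0.
apply: eq_esum => f _; apply: eq_esum => e _.
by rewrite TS innerC csq_conj.
Qed.

Definition is_HS H K (T : H -> K) :=
  (exists S : K -> H, is_adjoint T S) /\ (hs2 T < +oo)%E.

(** The squared Hilbert-Schmidt norm, as a real number. *)
Definition hsn H K (T : H -> K) : R := fine (hs2 T).

Lemma is_HS_adjoint H K (T : H -> K) (S : K -> H) :
  is_HS T -> is_adjoint T S -> is_HS S.
Proof.
move=> [_ T_oo] TS; split; last by rewrite -(hs2_adjoint TS).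
by exists T; exact: is_adjoint_sym.
Qed.

Lemma hsn_adjoint H K (T : H -> K) (S : K -> H) :
  is_adjoint T S -> hsn T = hsn S.
Proof. by move=> TS; rewrite /hsn (hs2_adjoint TS). Qed.

Lemma hs2E H K (T : H -> K) : is_HS T -> hs2 T = (hsn T)%:E.
Proof.
move=> [_ T_oo]; rewrite /hsn esum_fin_num// => e; rewrite lee_fin; exact: nsq_ge0.
Qed.

Lemma hsn_ge0 H K (T : H -> K) : 0 <= hsn T.
Proof. by apply/fine_ge0/esum_ge0 => e _; rewrite lee_fin nsq_ge0. Qed.

Lemma hsn_has_sum H K (T : H -> K) : is_HS T ->
  has_sum ((fun e : onb H => (nsq (T (val e)))%:C) : _ -> R[i]^o) ((hsn T)%:C : R[i]^o).
Proof.
move=> T_HS; apply/has_sum_ge0P; last exact: hs2E.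
by move=> e; exact: nsq_ge0.
Qed.

Arguments hsn_has_sum {H K T} _.

Lemma is_adjointDZ H K (u v : R[i]) (S T : H -> K) (S' T' : K -> H) :
  is_adjoint S S' -> is_adjoint T T' ->
  is_adjoint (u *: S + v *: T) (conjC u *: S' + conjC v *: T').
Proof.
move=> SS' TT' x y.
by rewrite !fctE innerDl innerDr !innerZl !innerZr SS' TT' !conjCK.
Qed.

(** The parallelogram law, where the squared norm of the difference is dropped. *)
Lemma nsqDZ_le H (u v : R[i]) (x y : H) :
  nsq (u *: x + v *: y) <= 2 * csq u * nsq x + 2 * csq v * nsq y.
Proof.
have := nsq_ge0 (u *: x + (- v) *: y); rewrite !nsqDZ.
rewrite rmorphN mulrN mulNr raddfN/= /csq !raddfN/= sqrrN; lra.
Qed.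

Lemma is_HSDZ H K (u v : R[i]) (S T : H -> K) :
  is_HS S -> is_HS T -> is_HS (u *: S + v *: T).
Proof.
move=> S_HS T_HS; split.
  have [[S' SS'] _] := S_HS; have [[T' TT'] _] := T_HS.
  by eexists; exact: is_adjointDZ SS' TT'.
apply: (@le_lt_trans _ _ (2 * csq u * hsn S + 2 * csq v * hsn T)%:E); last exact: ltry.
apply: esum_le_fset => B; rewrite sumEFin lee_fin.
have le_hsn (U : H -> K) : is_HS U -> \sum_(e <- B) nsq (U (val e)) <= hsn U.
  move=> U_HS; rewrite -lee_fin -hs2E// -sumEFin; apply: esum_ge_fset => e.
  by rewrite lee_fin nsq_ge0.
apply: (@le_trans _ _ (\sum_(e <- B)
    (2 * csq u * nsq (S (val e)) + 2 * csq v * nsq (T (val e))))).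
  by apply: ler_sum => e _; exact: nsqDZ_le.
rewrite big_split/= -!mulr_sumr lerD// ler_wpM2l ?mulr_ge0 ?csq_ge0//; exact: le_hsn.
Qed.

Lemma is_HSZ H K (u : R[i]) (S : H -> K) : is_HS S -> is_HS (u *: S).
Proof.
by move=> S_HS; have := is_HSDZ u 0 S_HS S_HS; rewrite scale0r addr0.
Qed.

Lemma is_HSD H K (S T : H -> K) : is_HS S -> is_HS T -> is_HS (S + T).
Proof.
by move=> S_HS T_HS; have := is_HSDZ 1 1 S_HS T_HS; rewrite !scale1r.
Qed.

Lemma is_HSN H K (S : H -> K) : is_HS S -> is_HS (- S).
Proof. by rewrite -scaleN1r; exact: is_HSZ. Qed.

Lemma is_HS0 H K : is_HS (0 : H -> K).
Proof.
have zero (U V : hilbertType R) (x : U) : (0 : U -> V) x = 0 by [].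
split; first by exists 0 => x y; rewrite !zero inner0l inner0r.
by rewrite /hs2 esum1 ?ltry// => e _; rewrite zero /nsq inner0l.
Qed.

(** The inner product [<x, y>] in terms of [p = |x + y|^2], [q = |x + i y|^2],
    [r = |x|^2] and [s = |y|^2]: by [polarizeP] its real part is [(p - r - s) / 2] and
    its imaginary part [(q - r - s) / 2]. *)
Definition polarize (p q r s : R) : R[i] :=
  2^-1 * (p%:C + 'i * q%:C - (1 + 'i) * (r%:C + s%:C)).

Lemma polarizeP (z : R[i]) (p q r s : R) :
  p - (r + s) = 2 * complex.Re z -> q - (r + s) = 2 * complex.Im z ->
  z = polarize p q r s.
Proof.
case: z => a b /= pE qE.
have -> : p = 2 * a + (r + s) by rewrite -pE subrK.
have -> : q = 2 * b + (r + s) by rewrite -qE subrK.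
have n2 : (2 : R[i]) != 0 by rewrite pnatr_eq0.
apply: (mulfI n2); rewrite /polarize mulrA divff// mul1r mulr_natl mulr2n.
by apply/eqP; rewrite eq_complex /=; apply/andP; split; apply/eqP; ring.
Qed.

Lemma inner_polarize H (x y : H) :
  inner x y = polarize (nsq (x + y)) (nsq (x + 'i *: y)) (nsq x) (nsq y).
Proof.
apply: polarizeP; first by rewrite nsqD; ring.
have := nsqDZ 1 'i x y; rewrite !scale1r mul1r => ->.
by case: (inner x y) => a b; rewrite /csq /=; ring.
Qed.

Lemma mul_conjC_polarize (a b : R[i]) :
  a * conjC b = polarize (csq (a + b)) (csq (a + 'i * b)) (csq a) (csq b).
Proof.
by case: a b => [a a'] [b b']; apply: polarizeP; rewrite /csq /=; ring.
Qed.

Lemma has_sum_polarize (I : choiceType) (p q r s : I -> R) (P Q S T : R) :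
  has_sum ((fun i => (p i)%:C) : I -> R[i]^o) (P%:C : R[i]^o) ->
  has_sum ((fun i => (q i)%:C) : I -> R[i]^o) (Q%:C : R[i]^o) ->
  has_sum ((fun i => (r i)%:C) : I -> R[i]^o) (S%:C : R[i]^o) ->
  has_sum ((fun i => (s i)%:C) : I -> R[i]^o) (T%:C : R[i]^o) ->
  has_sum ((fun i => polarize (p i) (q i) (r i) (s i)) : I -> R[i]^o)
    (polarize P Q S T : R[i]^o).
Proof.
move=> hp hq hr hs.
have h := has_sumZ (2^-1) (has_sumD (has_sumD hp (has_sumZ 'i hq))
  (has_sumZ (- (1 + 'i)) (has_sumD hr hs))).
rewrite /polarize; have -> : (fun i => 2^-1 * ((p i)%:C + 'i * (q i)%:C -
  (1 + 'i) * ((r i)%:C + (s i)%:C))) = (fun i => 2^-1 *: ((p i)%:C + 'i *: ((q i)%:C : R[i]^o) +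
  (- (1 + 'i)) *: ((r i)%:C + (s i)%:C : R[i]^o))) :> (I -> R[i]^o).
  by apply/funext => i; rewrite -mulNr.
by rewrite -mulNr.
Qed.

Arguments has_sum_polarize {I p q r s P Q S T} _ _ _ _.

(** Defined by polarization, so that convergence of the sum of the [<S e, T e>], and any
    identity between inner products, follow from facts about squared norms. *)
Definition hs_ip H K (S T : H -> K) : R[i] :=
  polarize (hsn (S + T)) (hsn (S + 'i *: T)) (hsn S) (hsn T).

Lemma hs_ip_has_sum H K (S T : H -> K) : is_HS S -> is_HS T ->
  has_sum ((fun e : onb H => inner (S (val e)) (T (val e))) : _ -> R[i]^o)
    (hs_ip S T : R[i]^o).
Proof.
move=> S_HS T_HS.
have h := has_sum_polarize (hsn_has_sum (is_HSD S_HS T_HS))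
  (hsn_has_sum (is_HSD S_HS (is_HSZ 'i T_HS))) (hsn_has_sum S_HS) (hsn_has_sum T_HS).
rewrite (_ : (fun e : onb H => inner _ _) = fun e => polarize (nsq ((S + T) (val e)))
  (nsq ((S + 'i *: T) (val e))) (nsq (S (val e))) (nsq (T (val e))))//.
by apply/funext => e; rewrite inner_polarize.
Qed.

Arguments hs_ip_has_sum {H K S T} _ _.

Lemma hsnDZ H K (u v : R[i]) (S T : H -> K) : is_HS S -> is_HS T ->
  hsn (u *: S + v *: T) = csq u * hsn S + csq v * hsn T
    + 2 * complex.Re (u * conjC v * hs_ip S T).
Proof.
move=> S_HS T_HS; apply: complexI.
apply: (has_sum_unique (hsn_has_sum (is_HSDZ u v S_HS T_HS))).
have realC_comb (a b c d r : R) :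
    (a * b + c * d + r)%:C = a%:C * b%:C + c%:C * d%:C + r%:C :> R[i].
  by rewrite !rmorphD !rmorphM.
(* The real part is not linear over the complex numbers, so the cross term goes through
   a map that is only additive. *)
pose w := u * conjC v; pose g (z : R[i]^o) : R[i]^o := (2 * complex.Re (w * z))%:C.
have gB x y : g (x - y) = g x - g y.
  by rewrite /g mulrBr raddfB/= mulrBr rmorphB.
have gM x : `|g x| <= `|w| * 2 * `|x|.
  rewrite /g normC_real normrM (ger0_norm (ler0n _ 2)) rmorphM/= rmorph_nat.
  rewrite (_ : `|w| * 2 * `|x| = 2 * `|w * (x : R[i])|).
    by rewrite ler_wpM2l ?ler0n// normc_ge_Re.
  by rewrite [in RHS]normrM mulrAC mulrC.
have hg := has_sum_lipschitz gB gM (hs_ip_has_sum S_HS T_HS).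
have h := has_sumD (has_sumD (has_sumZ (csq u)%:C (hsn_has_sum S_HS))
  (has_sumZ (csq v)%:C (hsn_has_sum T_HS))) hg.
rewrite (_ : (fun e : onb H => _) = (fun e : onb H => (csq u)%:C * (nsq (S (val e)))%:C +
   (csq v)%:C * (nsq (T (val e)))%:C + g (inner (S (val e)) (T (val e))))).
  by rewrite realC_comb; exact: h.
apply/funext => e; rewrite fctE nsqDZ /g.
by rewrite realC_comb.
Qed.

End HilbertSchmidt.
Arguments hsn_has_sum {R H K T} _.
Arguments has_sum_polarize {R I p q r s P Q S T} _ _ _ _.
Arguments hs_ip_has_sum {R H K S T} _ _.

(** * Traces of products and operator matrices *)

Section Traces.
Context (R : realType).
Implicit Types H K : hilbertType R.

Lemma is_adjointZ_lin H K (T : H -> K) (S : K -> H) (a : R[i]) (x : H) :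
  is_adjoint T S -> T (a *: x) = a *: T x.
Proof.
move=> TS; apply: inner_ext => z.
by rewrite innerC TS innerZl rmorphM/= -TS -innerC innerZr.
Qed.

Lemma is_adjointD_lin H K (T : H -> K) (S : K -> H) (x y : H) :
  is_adjoint T S -> T (x + y) = T x + T y.
Proof.
move=> TS; apply: inner_ext => z.
by rewrite innerC TS innerDl rmorphD/= -!TS -!innerC innerDr.
Qed.

Lemma traceE H (T : H -> H) (l : R[i]) :
  has_sum (diag_coef T) (l : R[i]^o) -> trace T = l.
Proof. by move=> h; apply: (cvg_lim _ h); exact: norm_hausdorff. Qed.

Lemma diag_coef_comp H (X Y Y' : H -> H) : is_adjoint Y Y' ->
  diag_coef (Y \o X) = fun e : onb H => inner (X (val e)) (Y' (val e)).
Proof. by move=> YY'; apply/funext => e; rewrite /diag_coef /= YY'. Qed.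

Lemma trace_comp_has_sum H (X Y Y' : H -> H) :
  is_adjoint Y Y' -> is_HS X -> is_HS Y ->
  has_sum (diag_coef (Y \o X)) (hs_ip X Y' : R[i]^o).
Proof.
move=> YY' X_HS Y_HS; rewrite (diag_coef_comp _ YY'); apply: hs_ip_has_sum => //.
exact: is_HS_adjoint YY'.
Qed.

Lemma trace_comp H (X Y Y' : H -> H) :
  is_adjoint Y Y' -> is_HS X -> is_HS Y -> trace (Y \o X) = hs_ip X Y'.
Proof. by move=> YY' X_HS Y_HS; apply/traceE/trace_comp_has_sum. Qed.

(** The diagonal coefficients of [T^* T] are the [|T e|^2], so convergence of the trace
    is finiteness of the squared norm. *)
Lemma hilbert_schmidt_is_HS H (T : H -> H) : hilbert_schmidt T -> is_HS T.
Proof.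
move=> [T_bd /cvg_ex[l hl]]; have TT := adjointP T_bd.
split; first by exists (adjoint T).
have coefE : diag_coef (adjoint T \o T) = fun e : onb H => (nsq (T (val e)))%:C.
  rewrite (diag_coef_comp _ (is_adjoint_sym TT)).
  by apply/funext => e; rewrite nsqE.
rewrite coefE in hl.
have l0 : 0 <= l.
  apply: (has_sum_cofinal_ge0 hl) => A; exists A; rewrite ?fsubset_refl//.
  by apply: sumr_ge0 => e _; rewrite ler0c nsq_ge0.
have lE : l = (complex.Re l)%:C by rewrite RRe_real// ger0_real.
rewrite lE in hl; move/has_sum_ge0P : hl => hl.
by rewrite /hs2 hl ?ltry// => e; exact: nsq_ge0.
Qed.

Lemma is_HS_adjointP H (T : H -> H) : is_HS T -> is_adjoint T (adjoint T).
Proof. by move=> [[S TS] _]; rewrite (is_adjointE TS). Qed.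

Lemma hs_normE H (T : H -> H) : is_HS T -> hs_norm T = Num.sqrt (hsn T).
Proof.
move=> T_HS; rewrite /hs_norm; congr Num.sqrt.
have TT := is_HS_adjointP T_HS.
rewrite (_ : trace _ = (hsn T)%:C)//; apply: traceE.
rewrite (diag_coef_comp _ (is_adjoint_sym TT)).
by under eq_fun do rewrite -nsqE; exact: hsn_has_sum.
Qed.

Lemma hs_norm_sqr H (T : H -> H) : is_HS T -> hs_norm T ^+ 2 = hsn T.
Proof. by move=> T_HS; rewrite hs_normE// sqr_sqrtr// hsn_ge0. Qed.

(** Used to identify two inner products of operators by comparing the cross terms in the
    squared norms of all combinations [u S + v T]. *)
Lemma Re_mul_inj (z z' : R[i]) :
  (forall u v : R[i], complex.Re (u * conjC v * z) = complex.Re (u * conjC v * z')) ->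
  z = z'.
Proof.
move=> h; have h1 := h 1 1; have hi := h 'i 1.
apply/eqP; rewrite eq_complex; apply/andP; split; apply/eqP.
  by move: h1; rewrite rmorph1 !mul1r.
move: hi; rewrite rmorph1 mulr1; case: z {h h1} => a b; case: z' => c d /=.
by rewrite !mul0r !mul1r !sub0r => /oppr_inj.
Qed.

(** The operators [u X + v Y^*] and [v^* Y + u^* X^*] are adjoint to each other and
    therefore have the same norm; the cross terms of the two squared norms involve
    [tr (Y X) = <X, Y^*>] and [tr (X Y) = <Y, X^*>]. *)
Lemma trace_comm H (X Y : H -> H) : is_HS X -> is_HS Y ->
  trace (Y \o X) = trace (X \o Y).
Proof.
move=> X_HS Y_HS; have XX := is_HS_adjointP X_HS; have YY := is_HS_adjointP Y_HS.
rewrite (trace_comp YY)// (trace_comp XX)//; apply: Re_mul_inj => u v.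
have X'_HS := is_HS_adjoint X_HS XX; have Y'_HS := is_HS_adjoint Y_HS YY.
have := hsn_adjoint (is_adjointDZ u v XX (is_adjoint_sym YY)).
rewrite hsnDZ// [conjC u *: _ + _]addrC hsnDZ// conjCK !csq_conj.
rewrite -(hsn_adjoint XX) -(hsn_adjoint YY) [conjC v * u]mulrC.
lra.
Qed.

Lemma trace_compZ H (a b : R[i]) (X Y : H -> H) : is_HS X -> is_HS Y ->
  trace ((b *: Y) \o (a *: X)) = a * b * trace (Y \o X).
Proof.
move=> X_HS Y_HS; have YY := is_HS_adjointP Y_HS.
have h := trace_comp_has_sum YY X_HS Y_HS.
rewrite (traceE h); apply: traceE.
rewrite (_ : diag_coef _ = fun e : onb H => (a * b) *: diag_coef (Y \o X) e).
  exact: has_sumZ.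
apply/funext => e; rewrite /diag_coef /= !fctE (is_adjointZ_lin _ _ YY) scalerA.
by rewrite innerZl [b * a]mulrC.
Qed.

Lemma trace_compN H (X Y : H -> H) : is_HS X -> is_HS Y ->
  (trace (Y \o - X) = - trace (Y \o X)) * (trace (- Y \o X) = - trace (Y \o X)).
Proof.
move=> X_HS Y_HS; split.
  by have := trace_compZ (-1) 1 X_HS Y_HS; rewrite scaleN1r scale1r mulr1 mulN1r.
by have := trace_compZ 1 (-1) X_HS Y_HS; rewrite scaleN1r scale1r mul1r mulN1r.
Qed.

Lemma trace_comp0 H : trace ((0 : H -> H) \o (0 : H -> H)) = 0.
Proof.
by have := trace_compZ 0 0 (is_HS0 H H) (is_HS0 H H); rewrite !scale0r !mul0r.
Qed.

Lemma trace_self_adjoint H (A : H -> H) : is_HS A -> self_adjoint A ->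
  trace (A \o A) = (hsn A)%:C.
Proof.
move=> A_HS AA; apply: traceE; have := is_HS_adjointP A_HS; rewrite AA => AA'.
rewrite (diag_coef_comp _ AA').
by under eq_fun do rewrite -nsqE; exact: hsn_has_sum.
Qed.

Lemma hsnZ H K a (T : H -> K) : is_HS T -> hsn (a *: T) = csq a * hsn T.
Proof.
move=> T_HS; have := hsnDZ a 0 T_HS T_HS; rewrite scale0r addr0 => ->.
by rewrite rmorph0 mulr0 mul0r /csq /= !expr0n/= addr0 mul0r mulr0 !addr0.
Qed.

Lemma hsnN H K (T : H -> K) : is_HS T -> hsn (- T) = hsn T.
Proof.
by move=> T_HS; rewrite -scaleN1r hsnZ// /csq /= oppr0 sqrrN expr1n expr0n addr0 mul1r.
Qed.

Lemma hsn0 H K : hsn (0 : H -> K) = 0.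
Proof.
have := hsnZ 0 (is_HS0 H K); rewrite scale0r => ->.
by rewrite /csq /= expr0n/= addr0 mul0r.
Qed.

Section Opmx.
Context H (A B C D A' B' C' D' : H -> H).
Hypotheses (AA : is_adjoint A A') (BB : is_adjoint B B')
  (CC : is_adjoint C C') (DD : is_adjoint D D').

Lemma dsum_innerE (x y : H \(+) H) : inner x y = inner x.1 y.1 + inner x.2 y.2.
Proof. by []. Qed.

Lemma is_adjoint_opmx : is_adjoint (opmx A B C D) (opmx A' C' B' D').
Proof.
move=> x y; rewrite !dsum_innerE /= !innerDl !innerDr AA BB CC DD.
by rewrite addrACA.
Qed.

(** The adjoint of the row is the column [y |-> (A' y, B' y)], defined on [H], so this
    sum over the basis of [H \(+) H] becomes one over the basis of [H]. *)
Lemma hs2_row : hs2 ((fun x => A x.1 + B x.2) : H \(+) H -> H) = (hs2 A + hs2 B)%E.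
Proof.
rewrite (@hs2_adjoint _ _ _ _ ((fun y => (A' y, B' y)) : H -> H \(+) H)).
  rewrite (hs2_adjoint AA) (hs2_adjoint BB) /hs2 -esumD; last first.
  - by move=> e _; rewrite lee_fin nsq_ge0.
  - by move=> e _; rewrite lee_fin nsq_ge0.
  by apply: eq_esum => e _; rewrite -EFinD /nsq -raddfD.
by move=> x y; rewrite dsum_innerE /= innerDl AA BB.
Qed.

End Opmx.

Lemma hs2_opmx H (A B C D : H -> H) : is_HS A -> is_HS B -> is_HS C -> is_HS D ->
  hs2 (opmx A B C D) = (hs2 A + hs2 B + (hs2 C + hs2 D))%E.
Proof.
move=> /is_HS_adjointP AA /is_HS_adjointP BB /is_HS_adjointP CC /is_HS_adjointP DD.
rewrite -(hs2_row AA BB) -(hs2_row CC DD) /hs2 -esumD.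
- by apply: eq_esum => e _; rewrite -EFinD /nsq -raddfD.
- by move=> e _; rewrite lee_fin nsq_ge0.
- by move=> e _; rewrite lee_fin nsq_ge0.
Qed.

Lemma hsn_opmx H (A B C D : H -> H) : is_HS A -> is_HS B -> is_HS C -> is_HS D ->
  hsn (opmx A B C D) = hsn A + hsn B + hsn C + hsn D.
Proof.
by move=> hA hB hC hD; rewrite /hsn hs2_opmx// !hs2E// -!EFinD /= addrA.
Qed.

Lemma is_HS_opmx H (A B C D : H -> H) : is_HS A -> is_HS B -> is_HS C -> is_HS D ->
  is_HS (opmx A B C D).
Proof.
move=> hA hB hC hD; split; last by rewrite hs2_opmx// !hs2E// -!EFinD ltry.
eexists; apply: is_adjoint_opmx; exact: is_HS_adjointP.
Qed.

Lemma opmxD H (A B C D A' B' C' D' : H -> H) :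
  opmx A B C D + opmx A' B' C' D' = opmx (A + A') (B + B') (C + C') (D + D').
Proof.
by apply/funext => x; congr pair; exact: addrACA.
Qed.

Lemma opmxZ H a (A B C D : H -> H) :
  a *: opmx A B C D = opmx (a *: A) (a *: B) (a *: C) (a *: D).
Proof.
by apply/funext => x; congr pair; exact: scalerDr.
Qed.

(** Polarization is additive in its four arguments, so the inner product of [M] and
    [M^*] splits, like squared norms, into the inner products of their entries. *)
Lemma trace_opmx H (A B C D : H -> H) : is_HS A -> is_HS B -> is_HS C -> is_HS D ->
  trace (opmx A B C D \o opmx A B C D) =
  trace (A \o A) + trace (B \o C) *+ 2 + trace (D \o D).
Proof.
move=> hA hB hC hD.
have AA := is_HS_adjointP hA; have BB := is_HS_adjointP hB.
have CC := is_HS_adjointP hC; have DD := is_HS_adjointP hD.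
rewrite mulr2n [X in _ + (X + _) + _]trace_comm//.
rewrite (trace_comp (is_adjoint_opmx AA BB CC DD)); [|exact: is_HS_opmx..].
rewrite (trace_comp AA)// (trace_comp BB)// (trace_comp CC)// (trace_comp DD)//.
rewrite /hs_ip opmxZ !opmxD.
have A'_HS := is_HS_adjoint hA AA; have B'_HS := is_HS_adjoint hB BB.
have C'_HS := is_HS_adjoint hC CC; have D'_HS := is_HS_adjoint hD DD.
rewrite !hsn_opmx; try by [|apply: is_HSD => //; apply: is_HSZ|apply: is_HSD].
by rewrite /polarize !rmorphD/=; ring.
Qed.

End Traces.

(** * The closed formula for the numerical radius *)

Section NumericalRadius.
Context (R : realType).
Implicit Types (H : hilbertType R) (nu : R).

Lemma expiE (t : R) : expi t * conjC (expi (- t)) = expi t ^+ 2.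
Proof.
rewrite expr2 /expi cosN sinN; congr (_ * _).
by apply/eqP; rewrite eq_complex /= opprK !eqxx.
Qed.

Lemma csq_expi (t : R) : csq (expi t) = 1.
Proof. exact: cos2Dsin2. Qed.

Lemma expi_sqrt (z : R[i]) : csq z = 1 -> exists t, expi t ^+ 2 = z.
Proof.
case: z => a b; rewrite /csq /= => ab.
have a1 : -1 <= a <= 1.
  rewrite -ler_norml -(@ler_pXn2r _ 2)// ?nnegrE// expr1n -normrX ger0_norm ?sqr_ge0//.
  by rewrite -ab lerDl sqr_ge0.
have expi2 t : expi t ^+ 2 = expi (t *+ 2).
  rewrite mulr2n /expi cosD sinD expr2; apply/eqP; rewrite eq_complex /=.
  by apply/andP; split; apply/eqP; ring.
pose t := acos a; have ct : cos t = a by apply: acosK; rewrite in_itv.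
have st : sin t = `|b|.
  rewrite sin_acos//; rewrite -ab addrC addKr sqrtr_sqr//.
have [b0|b0] := leP 0 b; [exists (t / 2)|exists (- t / 2)];
  rewrite expi2 mulr2n -splitr /expi ?cosN ?sinN ct st.
  by rewrite ger0_norm.
by rewrite ltr0_norm// opprK.
Qed.

Lemma Re_le_sqrt_csq (z : R[i]) : complex.Re z <= Num.sqrt (csq z).
Proof.
apply: (le_trans (ler_norm _)); rewrite -sqrtr_sqr ler_wsqrtr// lerDl sqr_ge0.
by [].
Qed.

(** The supremum over phases is attained: take [expi t ^+ 2] to be the conjugate of
    [z] divided by the modulus of [z]. *)
Lemma exists_phase (z : R[i]) :
  exists t, complex.Re (expi t ^+ 2 * z) = Num.sqrt (csq z).
Proof.
have [z0|z0] := eqVneq (csq z) 0.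
  exists 0; apply/eqP; rewrite z0 sqrtr0.
  have /eqP : csq (expi 0 ^+ 2 * z) = 0 by rewrite csqM z0 mulr0.
  by rewrite paddr_eq0 ?sqr_ge0// => /andP[]; rewrite sqrf_eq0.
set r := Num.sqrt (csq z).
have r0 : r != 0 by rewrite sqrtr_eq0 -ltNge lt_def z0 csq_ge0.
have rr : r ^+ 2 = csq z by rewrite sqr_sqrtr ?csq_ge0.
have [t tE] : exists t, expi t ^+ 2 = (r^-1)%:C * conjC z.
  apply: expi_sqrt; rewrite csqM csq_conj -rr /csq /= expr0n addr0 -exprMn.
  by rewrite mulVf// expr1n.
exists t; rewrite tE -mulrA [conjC z * z]mulrC -csqE -rmorphM -rr /=.
by rewrite expr2 mulKf.
Qed.

Lemma sup_max (E : set R) m : E m -> ubound E m -> sup E = m.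
Proof.
move=> Em Eub; apply/eqP; rewrite eq_le; apply/andP; split.
  by apply: ge_sup => //; exists m.
by apply: ub_le_sup => //; exists m.
Qed.

Lemma w2E nu H (T : H -> H) : 0 <= nu <= 1 -> is_HS T ->
  w2 nu T = Num.sqrt ((2 * nu ^+ 2 - 2 * nu + 1) * hsn T
    + 2 * nu * (1 - nu) * Num.sqrt (csq (trace (T \o T)))).
Proof.
move=> /andP[nu0 nu1] T_HS; have TT := is_HS_adjointP T_HS.
have T'_HS := is_HS_adjoint T_HS TT.
have normE t : hs_norm ((nu%:C * expi t) *: T + ((1 - nu)%:C * expi (- t)) *: adjoint T)
  = Num.sqrt ((2 * nu ^+ 2 - 2 * nu + 1) * hsn T
    + 2 * nu * (1 - nu) * complex.Re (expi t ^+ 2 * trace (T \o T))).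
  rewrite hs_normE; last exact: is_HSDZ.
  rewrite hsnDZ// -(hsn_adjoint TT) !csqM !csq_expi (trace_comp TT)// -expiE.
  congr Num.sqrt; case: (hs_ip _ _) (expi t) (expi (- t)) => [a b] [c d] [e f].
  by rewrite /csq /=; ring.
apply: sup_max.
  have [t tE] := exists_phase (trace (T \o T)).
  by exists t => //=; rewrite normE tE.
move=> _ [t _ <-]; rewrite normE; apply: ler_wsqrtr; rewrite lerD2l.
apply: ler_wpM2l; first by rewrite !mulr_ge0// subr_ge0.
apply: (le_trans (Re_le_sqrt_csq _)).
by rewrite csqM expr2 csqM csq_expi !mul1r.
Qed.

Lemma w2_sqr nu H (T : H -> H) : 0 <= nu <= 1 -> is_HS T ->
  w2 nu T ^+ 2 = (2 * nu ^+ 2 - 2 * nu + 1) * hsn T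
    + 2 * nu * (1 - nu) * Num.sqrt (csq (trace (T \o T))).
Proof.
move=> nu01 T_HS; rewrite w2E// sqr_sqrtr//.
move: nu01 => /andP[nu0 nu1]; rewrite addr_ge0// !mulr_ge0 ?hsn_ge0 ?subr_ge0 ?sqrtr_ge0//.
have -> : 2 * nu ^+ 2 - 2 * nu + 1 = nu ^+ 2 + (1 - nu) ^+ 2 by ring.
by rewrite addr_ge0 ?sqr_ge0.
Qed.

End NumericalRadius.

(** * The trace of a product of positive operators *)

Section PositiveTrace.
Context (R : realType).
Implicit Types (H K : hilbertType R).

Local Notation psd n A :=
  (forall v : 'rV[R[i]]_n, 0 <= (v *m A *m (map_mx conjC v)^T) 0 0).

(** In an orthonormal basis of eigenvectors of [B], the trace is the sum of the products
    of the diagonal entries of [A] and [B], which are values of the two forms. *)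
Lemma psd_hermitian_trace_ge0 n (A B : 'M[R[i]]_n) :
  psd n A -> psd n B -> B = map_mx conjC B^T -> 0 <= \tr (A *m B).
Proof.
move=> Ap Bp Bh.
have /orthomx_spectralP : B \is normalmx.
  by apply/normalmxP; rewrite -[in RHS]Bh -Bh.
set P := spectralmx B; set d := spectral_diag B => BE.
have PU : P \is unitarymx by exact: spectral_unitarymx.
have PV : invmx P = map_mx conjC P^T by exact: invmx_unitary.
have diag_ge0 M i : psd n M -> 0 <= (P *m M *m invmx P) i i.
  move=> Mp; have := Mp (row i P).
  rewrite PV (_ : (map_mx conjC (row i P))^T = col i (map_mx conjC P^T)).
    rewrite -row_mul; move: (P *m M) (map_mx conjC P^T) => Q Q'.
    by rewrite !mxE; congr (_ <= _); apply: eq_bigr => j _; rewrite !mxE.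
  by apply/matrixP => k l; rewrite !mxE.
have PK : P *m invmx P = 1%:M by apply: mulmxV; exact: unitarymx_unit.
have dE : diag_mx d = P *m B *m invmx P.
  by rewrite BE !mulmxA PK mul1mx -mulmxA PK mulmx1.
rewrite BE !mulmxA mxtrace_mulC !mulmxA.
rewrite /mxtrace sumr_ge0// => i _.
rewrite mul_mx_diag mxE mulr_ge0//; first exact: diag_ge0.
have -> : d 0 i = (P *m B *m invmx P) i i by rewrite -dE mxE eqxx.
exact: diag_ge0.
Qed.

(** Over the complex numbers a form with real values on the diagonal is hermitian: the
    form of [A - A^*] vanishes on the diagonal, hence everywhere by polarization. *)
Lemma positive_is_adjoint H (A : H -> H) :
  (exists S, is_adjoint A S) -> positive A -> is_adjoint A A.
Proof.
move=> [S AS] Ap; have SA := is_adjoint_sym AS.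
pose D x := A x - S x.
have DD x y : D (x + y) = D x + D y.
  by rewrite /D (is_adjointD_lin _ _ AS) (is_adjointD_lin _ _ SA) opprD addrACA.
have DZ c x : D (c *: x) = c *: D x.
  by rewrite /D (is_adjointZ_lin _ _ AS) (is_adjointZ_lin _ _ SA) -scalerBr.
have Dxx x : inner (D x) x = 0.
  rewrite innerBl SA [inner x _]innerC; apply/eqP; rewrite subr_eq0 eq_sym.
  by apply/eqP/CrealP; rewrite ger0_real.
have Dxy x y : inner (D x) y + inner (D y) x = 0.
  by have := Dxx (x + y); rewrite DD innerDl !innerDr !Dxx addr0 add0r.
have Dxy0 x y : inner (D x) y = 0.
  have := Dxy x ('i *: y); rewrite DZ innerZr innerZl.
  have -> : inner (D y) x = - inner (D x) y.
    by apply/eqP; rewrite -addr_eq0 addrC Dxy.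
  rewrite (_ : conjC 'i = 0 -i* 1)//; case: (inner (D x) y) => c d [h1 h2].
  by apply/eqP; rewrite eq_complex /=; apply/andP; split; apply/eqP; lra.
have AE x : A x = S x.
  apply/eqP; rewrite -subr_eq0 -/(D x); apply/eqP/nsq_eq0.
  by rewrite /nsq Dxy0.
by move=> x y; rewrite AS AE.
Qed.

Lemma gram_psd H (A : H -> H) n (x : 'I_n -> H) : is_adjoint A A -> positive A ->
  psd n (\matrix_(i, j) inner (A (x i)) (x j)).
Proof.
move=> AA Ap v; pose y := \sum_i v 0 i *: x i.
have A0 : A 0 = 0 by have := is_adjointZ_lin 0 0 AA; rewrite !scale0r.
have Ay : A y = \sum_i v 0 i *: A (x i).
  rewrite (big_morph A (fun x y => is_adjointD_lin x y AA) A0).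
  by apply: eq_bigr => i _; rewrite (is_adjointZ_lin _ _ AA).
rewrite (_ : (_ *m _) 0 0 = inner (A y) y)//.
rewrite Ay inner_sumr mxE; apply: eq_bigr => j _.
rewrite inner_suml !mxE mulr_suml; apply: eq_bigr => i _.
by rewrite !mxE innerZr innerZl mulrC.
Qed.

(** The double sum is the trace of the product of two positive semidefinite matrices. *)
Lemma sum_box_ge0 H (A B : H -> H) (s : seq H) :
  is_adjoint A A -> is_adjoint B B -> positive A -> positive B ->
  0 <= \sum_(x <- s) \sum_(y <- s) inner (A x) y * conjC (inner (B x) y) :> R[i].
Proof.
move=> AA BB Ap Bp; pose x i := tnth (in_tuple s) i.
have := psd_hermitian_trace_ge0 (gram_psd x AA Ap) (gram_psd x BB Bp).
rewrite (_ : \tr _ = \sum_(x <- s) \sum_(y <- s) inner (A x) y * conjC (inner (B x) y)).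
  by apply; apply/matrixP => i j; rewrite !mxE BB innerC.
rewrite big_tnth; apply: eq_bigr => i _; rewrite big_tnth mxE.
by apply: eq_bigr => j _; rewrite !mxE BB; congr (_ * _); exact: innerC.
Qed.

(** Expanding [A e] and [B e] in the basis turns [tr (B A)] into the unordered sum of
    [<A e, f> <B e, f>^*] over pairs of basis vectors. Every finite set of pairs is
    contained in a square [F * F], and the partial sums over squares are
    nonnegative by the finite-dimensional case. *)
Lemma trace_ge0 H (A B : H -> H) : is_HS A -> is_HS B -> positive A -> positive B ->
  0 <= trace (B \o A).
Proof.
move=> A_HS B_HS Ap Bp.
have AA : is_adjoint A A by apply: positive_is_adjoint => //; case: A_HS.
have BB : is_adjoint B B by apply: positive_is_adjoint => //; case: B_HS.
rewrite (trace_comp BB)//.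
pose a (p : onb H * onb H) := inner (A (val p.1)) (val p.2).
pose b (p : onb H * onb H) := inner (B (val p.1)) (val p.2).
have pair_sum (T : H -> H) : is_HS T ->
    has_sum ((fun p : onb H * onb H => (csq (inner (T (val p.1)) (val p.2)))%:C) : _ -> R[i]^o)
    ((hsn T)%:C : R[i]^o).
  move=> T_HS; apply/has_sum_ge0P => [p|]; first exact: csq_ge0.
  rewrite -hs2E// /hs2; under [RHS]eq_esum do rewrite -parseval.
  rewrite esum_esum => [|e f _ _]; last by rewrite lee_fin csq_ge0.
  by congr esum; apply/seteqP; split.
have h := has_sum_polarize (pair_sum _ (is_HSD A_HS B_HS))
  (pair_sum _ (is_HSD A_HS (is_HSZ 'i B_HS))) (pair_sum _ A_HS) (pair_sum _ B_HS).
have {}h : has_sum ((fun p => a p * conjC (b p)) : _ -> R[i]^o) (hs_ip A B : R[i]^o).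
  rewrite (_ : (fun p => _) = fun p : onb H * onb H => polarize
    (csq (inner ((A + B) (val p.1)) (val p.2)))
    (csq (inner ((A + 'i *: B) (val p.1)) (val p.2)))
    (csq (inner (A (val p.1)) (val p.2))) (csq (inner (B (val p.1)) (val p.2))))//.
  by apply/funext => p; rewrite mul_conjC_polarize !fctE !innerDl innerZl.
apply: (has_sum_cofinal_ge0 h) => J.
pose F := ((fst @` J) `|` (snd @` J))%fset.
exists (F `*` F)%fset.
  apply/fsubsetP => -[e f] J_ef; rewrite in_fsetM !in_fsetU /=.
  apply/andP; split; apply/orP; [left|right].
    by apply/imfsetP; exists (e, f).
  by apply/imfsetP; exists (e, f).
rewrite (_ : \sum_(p <- _) _ = \sum_(x <- map val F) \sum_(y <- map val F)
    inner (A x) y * conjC (inner (B x) y)); first exact: sum_box_ge0.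
rewrite big_map big_imfset2/=.
  by apply: eq_bigr => e _; rewrite big_map.
by move=> [e f] [e' f'] _ _ /= [-> ->].
Qed.
End PositiveTrace.

(** * The nine identities *)

Section Modulus.
Context (R : realType).

Lemma modulus_mul2n (z : R[i]) : Num.sqrt (csq (z *+ 2)) = 2 * Num.sqrt (csq z).
Proof.
have -> : csq (z *+ 2) = 2 ^+ 2 * csq z.
  by rewrite mulr2n; case: z => a b; rewrite /csq /=; ring.
by rewrite sqrtrM ?sqr_ge0// sqrtr_sqr ger0_norm.
Qed.

Lemma modulus_real (x : R) : 0 <= x -> Num.sqrt (csq x%:C) = x.
Proof. by move=> x0; rewrite /csq /= expr0n addr0 sqrtr_sqr ger0_norm. Qed.

Lemma modulus0 : Num.sqrt (csq (0 : R[i])) = 0 :> R.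
Proof. exact: (modulus_real (lexx 0)). Qed.

End Modulus.

Section SelfAdjoint.
Context (R : realType).

Lemma hsnD (H : hilbertType R) (A B : H -> H) : is_HS A -> is_HS B -> self_adjoint B ->
  hsn (A + B) = hsn A + hsn B + 2 * complex.Re (trace (B \o A)).
Proof.
move=> A_HS B_HS BB; have := is_HS_adjointP B_HS; rewrite BB => BB'.
have := hsnDZ 1 1 A_HS B_HS; rewrite !scale1r (trace_comp BB')// rmorph1 !mul1r => ->.
by rewrite /csq/= expr1n expr0n addr0 !mul1r.
Qed.

Lemma self_adjointP (H : hilbertType R) (A : H -> H) : is_adjoint A A -> self_adjoint A.
Proof. exact: is_adjointE. Qed.

Lemma self_adjointD (H : hilbertType R) (A B : H -> H) : is_HS A -> is_HS B ->
  self_adjoint A -> self_adjoint B -> self_adjoint (A + B).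
Proof.
move=> /is_HS_adjointP + /is_HS_adjointP + AA BB; rewrite AA BB => AA' BB'.
by apply: is_adjointE => x y; rewrite !fctE innerDl innerDr AA' BB'.
Qed.

Lemma self_adjointN (H : hilbertType R) (A : H -> H) : is_HS A ->
  self_adjoint A -> self_adjoint (- A).
Proof.
move=> /is_HS_adjointP + AA; rewrite AA => AA'.
by apply: is_adjointE => x y; rewrite !fctE innerNl innerNr AA'.
Qed.

End SelfAdjoint.

Theorem theorem3p8 (R : realType) (H : hilbertType R) (A B C D : H -> H)
    (nu theta : R)
    (hsA : hilbert_schmidt A) (hsB : hilbert_schmidt B)
    (hsC : hilbert_schmidt C) (hsD : hilbert_schmidt D)
    (nu01 : 0 <= nu <= 1) :
  (* (i) *)
  w2 nu (opmx 0 A B 0) = w2 nu (opmx 0 B A 0) /\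
  (* (ii) *)
  w2 nu (opmx 0 A B 0) = w2 nu (opmx 0 A (expi theta *: B) 0) /\
  (* (iii) *)
  w2 nu (opmx A A (- A) (- A))
    = 2 * Num.sqrt (2 * nu ^+ 2 - 2 * nu + 1) * hs_norm A /\
  (* (iv) *)
  w2 nu (opmx 0 A A 0) = Num.sqrt 2 * w2 nu A /\
  (* (v) *)
  w2 nu (opmx A B 0 0) ^+ 2
    = w2 nu A ^+ 2 + (2 * nu ^+ 2 - 2 * nu + 1) * hs_norm B ^+ 2 /\
  (* (vi) *)
  (trace (B \o C) = 0 ->
   w2 nu (opmx A B C ('i *: A)) ^+ 2
     = (2 * nu ^+ 2 - 2 * nu + 1)
       * (2 * hs_norm A ^+ 2 + hs_norm B ^+ 2 + hs_norm C ^+ 2)) /\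
  (* (vii) *)
  (positive A -> positive B ->
   w2 nu (opmx 0 A B 0) ^+ 2
     = (hs_norm (A + B) ^+ 2 + (1 - 2 * nu) ^+ 2 * hs_norm (A - B) ^+ 2) / 2) /\
  (* (viii) *)
  (self_adjoint A -> self_adjoint B ->
   w2 nu (opmx A 0 0 B) ^+ 2 = w2 nu A ^+ 2 + w2 nu B ^+ 2) /\
  (* (ix) *)
  (self_adjoint A -> self_adjoint B ->
   w2 nu (opmx A B B A) ^+ 2 = w2 nu (A + B) ^+ 2 + w2 nu (A - B) ^+ 2).
Proof.
have A_HS := hilbert_schmidt_is_HS hsA; have B_HS := hilbert_schmidt_is_HS hsB.
have C_HS := hilbert_schmidt_is_HS hsC.
have O_HS := is_HS0 H H; have NA_HS := is_HSN A_HS; have NB_HS := is_HSN B_HS.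
have alpha_ge0 : 0 <= 2 * nu ^+ 2 - 2 * nu + 1.
  have -> : 2 * nu ^+ 2 - 2 * nu + 1 = nu ^+ 2 + (1 - nu) ^+ 2 by ring.
  by rewrite addr_ge0 ?sqr_ge0.
have w2_opmxE X Y Z W : is_HS X -> is_HS Y -> is_HS Z -> is_HS W ->
    w2 nu (opmx X Y Z W) = Num.sqrt ((2 * nu ^+ 2 - 2 * nu + 1)
      * (hsn X + hsn Y + hsn Z + hsn W) + 2 * nu * (1 - nu) * Num.sqrt (csq
        (trace (X \o X) + trace (Y \o Z) *+ 2 + trace (W \o W)))).
  by move=> hX hY hZ hW; rewrite w2E ?trace_opmx ?hsn_opmx//; exact: is_HS_opmx.
have w2_opmx_sqr X Y Z W : is_HS X -> is_HS Y -> is_HS Z -> is_HS W ->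
    w2 nu (opmx X Y Z W) ^+ 2 = (2 * nu ^+ 2 - 2 * nu + 1)
      * (hsn X + hsn Y + hsn Z + hsn W) + 2 * nu * (1 - nu) * Num.sqrt (csq
        (trace (X \o X) + trace (Y \o Z) *+ 2 + trace (W \o W))).
  by move=> hX hY hZ hW; rewrite w2_sqr ?trace_opmx ?hsn_opmx//; exact: is_HS_opmx.
split; [|split; [|split; [|split; [|split; [|split; [|split; [|split]]]]]]].
- rewrite !w2_opmxE// (trace_comm B_HS A_HS) !hsn0 !add0r !addr0.
  by rewrite [hsn A + _]addrC.
- have E_HS := is_HSZ (expi theta) B_HS.
  rewrite !w2_opmxE// hsnZ// csq_expi mul1r trace_comp0 !add0r !addr0.
  have := trace_compZ (expi theta) 1 B_HS A_HS; rewrite scale1r mulr1 => ->.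
  by rewrite -mulrnAr csqM csq_expi mul1r.
- rewrite w2_opmxE// !hsnN// !trace_compN// !opprK.
  rewrite (_ : _ + _ + trace _ = 0); last by rewrite mulr2n; ring.
  rewrite modulus0 mulr0 addr0 hs_normE// -mulrA -sqrtrM//.
  set a := 2 * nu ^+ 2 - 2 * nu + 1.
  have -> : a * (hsn A + hsn A + hsn A + hsn A) = 2 ^+ 2 * (a * hsn A) by ring.
  by rewrite [LHS]sqrtrM ?sqr_ge0// sqrtr_sqr ger0_norm.
- rewrite w2_opmxE// hsn0 trace_comp0 !add0r !addr0 modulus_mul2n w2E// -sqrtrM//.
  by congr Num.sqrt; ring.
- rewrite w2_opmx_sqr// w2_sqr// hs_norm_sqr// hsn0.
  have -> : trace (B \o 0) = 0.
    by have := trace_compZ 0 1 B_HS B_HS; rewrite scale0r scale1r !mul0r.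
  by rewrite trace_comp0 mul0rn !addr0; ring.
- move=> BC0; rewrite w2_opmx_sqr//; last exact: is_HSZ.
  rewrite BC0 mul0rn addr0 trace_compZ// -{1}[trace (A \o A)]mul1r -mulrDl.
  rewrite (_ : 1 + 'i * 'i = 0); last by rewrite -expr2 sqr_i subrr.
  rewrite mul0r modulus0 hsnZ// !hs_norm_sqr// /csq /=.
  by ring.
- move=> Ap Bp.
  have BA0 := trace_ge0 A_HS B_HS Ap Bp.
  have BB : self_adjoint B.
    by apply/self_adjointP/positive_is_adjoint => //; case: B_HS.
  have BAE : trace (B \o A) = (complex.Re (trace (B \o A)))%:C.
    by rewrite RRe_real// ger0_real.
  rewrite w2_opmx_sqr// !hs_norm_sqr; [|exact: is_HSD..].
  rewrite !hsnD//; last exact: self_adjointN.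
  rewrite hsn0 trace_comp0 !add0r !addr0 (trace_comm B_HS A_HS) modulus_mul2n.
  rewrite (trace_compN A_HS B_HS).2 hsnN// [complex.Re (- _)]raddfN/=.
  rewrite {1}BAE modulus_real; last by move: BA0; rewrite lecE => /andP[].
  by field.
- move=> AA BB; rewrite w2_opmx_sqr// !w2_sqr// trace_comp0 !trace_self_adjoint//.
  by rewrite mul0rn addr0 -rmorphD !modulus_real ?addr_ge0 ?hsn_ge0// hsn0; ring.
- move=> AA BB; have AB_HS := is_HSD A_HS B_HS; have AmB_HS := is_HSD A_HS NB_HS.
  rewrite w2_opmx_sqr// !w2_sqr// !trace_self_adjoint//; last 2 first.
  + exact: self_adjointD (self_adjointN _ _).
  + exact: self_adjointD.
  have -> : (hsn A)%:C + (hsn B)%:C *+ 2 + (hsn A)%:C = ((hsn A + hsn B) *+ 2)%:C :> R[i].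
    by rewrite rmorphMn rmorphD/=; ring.
  rewrite !modulus_real ?hsn_ge0 ?mulrn_wge0 ?addr_ge0 ?hsn_ge0//.
  rewrite (hsnD A_HS B_HS)// (hsnD A_HS NB_HS); last exact: self_adjointN.
  rewrite (trace_compN A_HS B_HS).2 [complex.Re (- _)]raddfN/= hsnN//.
  by ring.
Qed.
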